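(* There exists a universal constant $C\ge1$ such that the following holds. Let $f:\mathbb{R}^d\to\mathbb{R}_{\ge0}$ and $\mathcal{X}=\{x\in\mathbb{R}^d: f(x)\le v\}$, where $v\in\mathbb{R}_{\ge0}$. Suppose $f$ is locally $(L,D)$-smooth over $\mathcal{X}$, $\Vert\nabla f(x)\Vert\le G$ for all $x\in\mathcal{X}$, and $f$ satisfies the local gradient-domination property $$\Vert\nabla f(x)\Vert^2\ \ge\ 2\mu\,(f(x)-f(x^* ))\qquad\forall x\in\mathcal{X},$$ where $x^*\in\arg\min_{x\in\mathcal{X}}f(x)$. Let $\kappa=L/\mu>1$. Suppose the algorithm NAQGD (defined in the context) is initialized with $x_0\in\mathbb{R}^d$ such that $f(x_0)\le v/4$, and is run with step-size $0<\alpha\le\min\{D/(7G),1/(6L)\}$ and contraction factor $\gamma=\sqrt d/2^b$, where $b\ge C\log\left(\frac{d\kappa}{\kappa-1}\right)$. Suppose moreover that the noisy gradients satisfy $\Vert\widehat{\nabla f(x_t)}-\nabla f(x_t)\Vert\le\varepsilon_t$ for all $t\ge0$, and that for every $t\ge0$, $\varepsilon_t\le G$ and $\bar\varepsilon_t^2\le v\mu/60$, where $$\bar\varepsilon_t^2=\max_{s\in\{0,\dots,t\}}\left\{\left(1-\frac{\alpha\mu}{3}\right)^{t-s}\left(8\varepsilon_{s-1}^2+6\varepsilon_s^2\right)\right\},\qquad \varepsilon_s=0\ \text{ for } s<0.$$ Then for all $t\ge0$, $f(x_t)\le v/2$ and $$f(x_t)-f(x^* )\ \le\ \max\left\{\left(1-\frac{\alpha\mu}{3}\right)^t\left(f(x_0)-f(x^*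 )\right),\ \frac{15\,\bar\varepsilon_{t-1}^2}{\mu}\right\},$$ with the convention $\bar\varepsilon_{-1}=0$.
   Context: $\Vert\cdot\Vert$ is the Euclidean norm; $L,D,G,\mu>0$. A (differentiable) function $f:\mathbb{R}^d\to\mathbb{R}$ is locally $(L,D)$-smooth over $\mathcal{X}\subseteq\mathbb{R}^d$ if $\Vert\nabla f(x)-\nabla f(y)\Vert\le L\Vert x-y\Vert$ for all $x\in\mathcal{X}$ and all $y\in\mathbb{R}^d$ with $\Vert y-x\Vert\le D$. Scalar quantizer $\mathcal{Q}_{b,R}$ ($b$ a positive integer, $R\ge 0$): for $X\in\mathbb{R}^d$ with $\Vert X\Vert\le R$ (so each component $X_i\in[-R,R]$), partition $[-R,R]$ into $2^b$ bins of equal width and let $\tilde X_i$ be the center of the bin containing $X_i$; then $\mathcal{Q}_{b,R}(X)=\tilde X=[\tilde X_1,\dots,\tilde X_d]^\top$. Only the values of $\mathcal{Q}_{b,R}$ on $\{\Vert X\Vert\le R\}$ are specified. Algorithm NAQGD (noisy adaptively quantized gradient descent), with step-size $\alpha$, contraction factor $\gamma$, bit-precision $b$ and a sequence of noise bounds $\varepsilon_t\in\mathbb{R}_{\ge0}$, $t\ge 0$: at each iterate $x_t$ a noisy gradient $\widehat{\nabla f(x_t)}\in\mathbb{R}^d$ is available. Start from $x_0$, $g_{-1}=0$, and $R_0$ picked such that $\Vert\widehat{\nabla f(x_0)}\Vert\le R_0$. For $t=0,1,2,\dots$: $$i_t=\widehat{\nabla f(x_t)}-g_{t-1},\quad \tilde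 i_t=\mathcal{Q}_{b,R_t}(i_t),\quad g_t=g_{t-1}+\tilde i_t,\quad x_{t+1}=x_t-\alpha g_t,\quad R_{t+1}=\gamma R_t+\alpha L\Vert g_t\Vert+\varepsilon_t+\varepsilon_{t+1}.$$
   Formalization: The initial range R_0 is additionally required to satisfy 2γR_0 ≤ ‖∇f(x_0)‖ + ε_0; with R_0 arbitrarily large the claim fails (e.g. x_0 = x*, no noise, R_0 > 0 gives g_0 ≠ 0). *)

(* Defs.v *)
From HB Require Import structures.
From mathcomp Require Import all_boot all_order all_algebra.
From mathcomp Require Import all_classical all_reals all_analysis.

Set Implicit Arguments.
Unset Strict Implicit.
Unset Printing Implicit Defensive.

Import Order.TTheory GRing.Theory Num.Theory.
Import numFieldNormedType.Exports.

Local Open Scope classical_set_scope.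
Local Open Scope ring_scope.

(* The canonical norm of 'rV[R]_d is the sup norm, so the Euclidean norm is
   defined by hand. *)
Definition l2norm (R : realType) (d : nat) (x : 'rV[R]_d) : R :=
  Num.sqrt (\sum_(i < d) x 0 i ^+ 2).

Definition grad (R : realType) (d : nat) (f : 'rV[R]_d -> R) (x : 'rV[R]_d) :
  'rV[R]_d := \row_(i < d) 'D_(delta_mx 0 i) f x.

(* Only x ranges over X; y ranges over the whole space. *)
Definition locally_smooth (R : realType) (d : nat) (L D : R)
    (X : set 'rV[R]_d) (f : 'rV[R]_d -> R) : Prop :=
  (forall x, differentiable f x) /\
  (forall x y, X x -> l2norm (y - x) <= D ->
     l2norm (grad f x - grad f y) <= L * l2norm (x - y)).

Definition is_argmin (R : realType) (T : Type) (X : set T) (f : T -> R)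
    (xs : T) : Prop :=
  X xs /\ forall x, X x -> f xs <= f x.

(* c is the center of one of the 2^b equal bins of [-r, r], and z lies in that
   bin.  Bins are closed: a point shared by two bins may be sent to either
   center, so every tie-breaking convention is covered. *)
Definition is_bin_center (R : realType) (b : nat) (r z c : R) : Prop :=
  let w := 2 * r / 2 ^+ b in
  exists k : nat, [/\ (k < 2 ^ b)%N,
    - r + k%:R * w <= z <= - r + k.+1%:R * w &
    c = - r + (k%:R + 2^-1) * w].

(* Q r is left unconstrained outside the Euclidean ball of radius r. *)
Definition is_scalar_quantizer (R : realType) (d b : nat)
    (Q : R -> 'rV[R]_d -> 'rV[R]_d) : Prop :=
  forall (r : R) (X : 'rV[R]_d), 0 <= r -> l2norm X <= r ->
    forall i : 'I_d, is_bin_center b r (X 0 i) (Q r X 0 i).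

(* The value u_{t-1}, with u_{-1} = 0. *)
Definition delayed (V : zmodType) (u : nat -> V) (t : nat) : V :=
  if t is s.+1 then u s else 0.

(* ghat t is the noisy gradient available at the iterate x t, and r t is the
   quantizer range (R_t in the usual notation). *)
Record NAQGD_run (R : realType) (d : nat) (Q : R -> 'rV[R]_d -> 'rV[R]_d)
    (alpha gamma L : R) (eps : nat -> R)
    (ghat x g : nat -> 'rV[R]_d) (r : nat -> R) : Prop := {
  NAQGD_range0 : l2norm (ghat 0%N) <= r 0%N ;
  NAQGD_g : forall t, g t = delayed g t + Q (r t) (ghat t - delayed g t) ;
  NAQGD_x : forall t, x t.+1 = x t - alpha *: g t ;
  NAQGD_range : forall t,
    r t.+1 = gamma * r t + alpha * L * l2norm (g t) + eps t + eps t.+1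
}.

(* The quantity \bar\varepsilon_t^2.  Taking 0 as the default value of the
   maximum is harmless: all the terms are nonnegative when alpha * mu <= 3. *)
Definition eps_bar2 (R : realType) (alpha mu : R) (eps : nat -> R) (t : nat) :
  R :=
  \big[Num.max/0]_(s < t.+1)
    ((1 - alpha * mu / 3) ^+ (t - s) *
     (8 * delayed eps s ^+ 2 + 6 * eps s ^+ 2)).

(* Main.v *)
Require Import Defs.
From HB Require Import structures.
From mathcomp Require Import all_boot all_order all_algebra.
From mathcomp Require Import all_classical all_reals all_analysis.
From mathcomp Require Import ring lra.

Set Implicit Arguments.
Unset Strict Implicit.
Unset Printing Implicit Defensive.

Import Order.TTheory GRing.Theory Num.Theory.
Import numFieldNormedType.Exports.

Local Open Scope classical_set_scope.
Local Open Scope ring_scope.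

(** Write [n_t] for the norm of [g t], [N_t] for the norm of the gradient at
    [x t], and [Delta_t = f (x t) - f xs].  The argument has three ingredients.

    The quantizer moves a vector in the ball of radius [r t] by at most
    [gamma * r t] ([quantization_error]).  The recursion defining the range is
    exactly what keeps the next quantizer input in the next ball: this input
    is the sum of the two noises, the change of the gradient along the step (at
    most [alpha * L * n_t] by local smoothness) and the quantization error
    ([innovation_in_range]).  Local smoothness applies because
    [gamma * r t <= 5 * G] persists, whence [n_t <= 7 * G] and
    [alpha * n_t <= D].

    The current iterate lies in the sublevel set and the step has length at
    most [D], so the usual quadratic upper bound holds along the step
    ([smooth_upper_bound]).  It makes gradient descent with an inexact gradient
    decrease [f] by [alpha / 2 * N_t ^ 2] and by a multiple of [n_t ^ 2], up to
    [alpha / 2] times the squared error of [g t]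
    ([gradient_step_descent]).

    The error inherited from the range is absorbed by a Lyapunov function.  With
    [P_t = gamma * (r t - eps t)] the error of [g t] is at most
    [P_t + 3 / 2 * eps t], and [P_t.+1 <= P_t / 2 + n_t / 12 + 3 / 4 * eps t].
    Subtracting [eps t] from the range matters: it makes [P_t] depend only on
    the noises before time [t], as the claimed bound does.  Then
    [V_t = Delta_t + alpha * P_t ^ 2] contracts by [1 - alpha * mu / 2] up to
    [15 * alpha * eps t ^ 2] ([potential_decrease]).  The claimed rate
    [1 - alpha * mu / 3] is slower, and the difference pays for the noise as
    soon as [V_t] exceeds [90 * eps t ^ 2 / mu]
    ([contraction_or_noise_floor]); the target bound satisfies the matching
    recursion ([rate_bound_step]).

    At [t = 0] the term [alpha * P_0 ^ 2] is not part of the target bound.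
    There [V_0 = Delta_0] and [P_0 = N_0 / 2] are used instead: the bound on the
    initial range says that the first quantization error is at most
    [P_0 + eps 0 / 2], and part of the descent [alpha / 2 * N_0 ^ 2] pays for
    it. *)

(** * The Euclidean norm *)

Definition dot (R : realType) (d : nat) (x y : 'rV[R]_d) : R :=
  \sum_(i < d) x 0 i * y 0 i.

Lemma l2norm_ge0 (R : realType) (d : nat) (x : 'rV[R]_d) : 0 <= l2norm x.
Proof. exact: sqrtr_ge0. Qed.

Lemma l2norm_sqr (R : realType) (d : nat) (x : 'rV[R]_d) :
  l2norm x ^+ 2 = \sum_(i < d) x 0 i ^+ 2.
Proof. by rewrite sqr_sqrtr // sumr_ge0 // => i _; exact: sqr_ge0. Qed.

Lemma l2norm0_eq0 (R : realType) (d : nat) (x : 'rV[R]_d) :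
  l2norm x = 0 -> x = 0.
Proof.
move=> x0; have /psumr_eq0P s0 : \sum_(i < d) x 0 i ^+ 2 = 0.
  by rewrite -l2norm_sqr x0 expr0n.
apply/rowP => i; rewrite mxE; apply/eqP.
by rewrite -sqrf_eq0 s0 // => j _; exact: sqr_ge0.
Qed.

Lemma dotZr (R : realType) (d : nat) (a : R) (x y : 'rV[R]_d) :
  dot x (a *: y) = a * dot x y.
Proof. by rewrite /dot mulr_sumr; apply: eq_bigr => i _; rewrite mxE; ring. Qed.

Lemma dotBl (R : realType) (d : nat) (x y z : 'rV[R]_d) :
  dot (x - y) z = dot x z - dot y z.
Proof.
by rewrite /dot -sumrB; apply: eq_bigr => i _; rewrite !mxE mulrBl.
Qed.

Lemma l2norm_sqrD (R : realType) (d : nat) (x y : 'rV[R]_d) :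
  l2norm (x + y) ^+ 2 = l2norm x ^+ 2 + 2 * dot x y + l2norm y ^+ 2.
Proof.
rewrite !l2norm_sqr /dot mulr_sumr -!big_split /=.
by apply: eq_bigr => i _; rewrite mxE; ring.
Qed.

Lemma l2normZ (R : realType) (d : nat) (a : R) (x : 'rV[R]_d) :
  l2norm (a *: x) = `|a| * l2norm x.
Proof.
rewrite /l2norm -(@sqrtr_sqr _ a) -sqrtrM ?sqr_ge0 // mulr_sumr.
by congr Num.sqrt; apply: eq_bigr => i _; rewrite mxE exprMn.
Qed.

Lemma l2normN (R : realType) (d : nat) (x : 'rV[R]_d) :
  l2norm (- x) = l2norm x.
Proof. by rewrite -scaleN1r l2normZ normrN1 mul1r. Qed.

Lemma l2norm_distC (R : realType) (d : nat) (x y : 'rV[R]_d) :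
  l2norm (x - y) = l2norm (y - x).
Proof. by rewrite -opprB l2normN. Qed.

Lemma cauchy_schwarz (R : realType) (d : nat) (x y : 'rV[R]_d) :
  dot x y <= l2norm x * l2norm y.
Proof.
have := l2norm_ge0 x; rewrite le_eqVlt => /orP[/eqP/esym x0|x_gt0].
  rewrite x0 mul0r (l2norm0_eq0 x0) /dot big1 // => i _.
  by rewrite mxE mul0r.
have := sqr_ge0 (l2norm (- (l2norm y *: x) + l2norm x *: y)).
rewrite l2norm_sqrD l2normN !l2normZ !ger0_norm ?l2norm_ge0 //.
rewrite dotZr -scaleNr.
have -> : dot (- l2norm y *: x) y = - l2norm y * dot x y.
  by rewrite /dot mulr_sumr; apply: eq_bigr => i _; rewrite mxE; ring.
have := l2norm_ge0 y; rewrite le_eqVlt => /orP[/eqP/esym y0 _|y_gt0].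
  rewrite y0 mulr0 (l2norm0_eq0 y0) /dot big1 // => i _.
  by rewrite mxE mulr0.
move=> h; rewrite -subr_ge0 -(@pmulr_rge0 _ (2 * (l2norm x * l2norm y))).
  by apply: le_trans h _; rewrite le_eqVlt; apply/orP; left; apply/eqP; ring.
by rewrite mulr_gt0 // mulr_gt0.
Qed.

Lemma ler_l2normD (R : realType) (d : nat) (x y : 'rV[R]_d) :
  l2norm (x + y) <= l2norm x + l2norm y.
Proof.
rewrite -ler_sqr ?nnegrE ?addr_ge0 ?l2norm_ge0 // l2norm_sqrD.
have := cauchy_schwarz x y; lra.
Qed.

Lemma l2norm_le_const (R : realType) (d : nat) (c : R) (x : 'rV[R]_d) :
  0 <= c -> (forall i, `|x 0 i| <= c) -> l2norm x <= Num.sqrt d%:R * c.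
Proof.
move=> c0 xc; rewrite -ler_sqr ?nnegrE ?mulr_ge0 ?l2norm_ge0 ?sqrtr_ge0 //.
rewrite l2norm_sqr exprMn sqr_sqrtr ?ler0n //.
have -> : d%:R * c ^+ 2 = \sum_(i < d) c ^+ 2.
  by rewrite sumr_const card_ord mulr_natl.
apply: ler_sum => i _; rewrite -real_normK ?num_real //.
by rewrite ler_sqr ?nnegrE.
Qed.

(** * Quantization *)

(** The center of a bin of width [2 * r / 2 ^ b] is within [r / 2 ^ b] of each
    of its points, and passing from coordinates to the Euclidean norm costs
    [sqrt d]. *)
Lemma quantization_error (R : realType) (d b : nat)
    (Q : R -> 'rV[R]_d -> 'rV[R]_d) (r : R) (z : 'rV[R]_d) :
  is_scalar_quantizer b Q -> l2norm z <= r ->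
  l2norm (Q r z - z) <= Num.sqrt d%:R / 2 ^+ b * r.
Proof.
move=> hQ zr; have r0 : 0 <= r := le_trans (l2norm_ge0 _) zr.
rewrite -mulrA; apply: l2norm_le_const => [|i].
  by rewrite mulr_ge0 ?invr_ge0 ?exprn_ge0.
have [k [_ /andP[lo hi] qE]] := hQ _ _ r0 zr i; rewrite !mxE qE.
move: lo hi; rewrite -[k.+1%:R]natr1; set w := 2 * r / _ => lo hi.
have -> : (2 ^+ b)^-1 * r = w / 2 by rewrite /w; field; rewrite expf_neq0.
by rewrite ler_norml; lra.
Qed.

(** * Gradient steps on locally smooth functions *)

Lemma derive_gradE (R : realType) (d : nat) (f : 'rV[R]_d -> R)
    (x h : 'rV[R]_d) :
  differentiable f x -> 'D_h f x = dot (grad f x) h.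
Proof.
move=> df; rewrite deriveE // {1}[h]row_sum_delta linear_sum /dot.
by apply: eq_bigr => i _; rewrite linearZ /= mxE deriveE // mulrC.
Qed.

(** The difference quotients of the restriction of [f] to a line are those
    defining the directional derivative, so no chain rule is involved. *)
Lemma is_derive_line (R : realType) (d : nat) (f : 'rV[R]_d -> R)
    (x h : 'rV[R]_d) (s : R) :
  differentiable f (s *: h + x) ->
  is_derive s (1 : R) (fun s => f (s *: h + x)) (dot (grad f (s *: h + x)) h).
Proof.
move=> df.
have E : (fun k : R => k^-1 *: (f ((k *: 1 + s) *: h + x) - f (s *: h + x))) =
         (fun k => k^-1 *: (f (k *: h + (s *: h + x)) - f (s *: h + x))).
  by apply/funext => k; rewrite [k *: 1]mulr1 scalerDl addrA.
apply: DeriveDef.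
  by rewrite /derivable /= E; exact: diff_derivable.
by rewrite -derive_gradE // /derive /= E.
Qed.

(** The mean value theorem for [f] along the segment minus its quadratic upper
    model [A * s + B * s ^ 2]: by Cauchy-Schwarz the derivative of the
    difference is nonpositive. *)
Lemma smooth_upper_bound (R : realType) (d : nat) (f : 'rV[R]_d -> R) (L : R)
    (x h : 'rV[R]_d) :
  (forall z, differentiable f z) ->
  (forall s, 0 <= s <= 1 ->
     l2norm (grad f (s *: h + x) - grad f x) <= L * (s * l2norm h)) ->
  f (x + h) <= f x + dot (grad f x) h + L / 2 * l2norm h ^+ 2.
Proof.
move=> df smooth.
pose A := dot (grad f x) h; pose B := L / 2 * l2norm h ^+ 2.
pose psi (s : R) := f (s *: h + x) - (A * s + B * s ^+ 2).
pose dpsi (s : R) := dot (grad f (s *: h + x)) h - (A + B * (2 * s)).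
have dpsiP s : is_derive s (1 : R) psi (dpsi s).
  have := is_derive_line (df (s *: h + x)) => dl.
  apply: is_derive_eq; rewrite /dpsi; congr (_ - _).
  by rewrite /GRing.scale /=; ring.
have psi_cont : {within `[0, 1], continuous psi}.
  by apply: derivable_within_continuous => s _; have := dpsiP s; move=> ?; exact: ex_derive.
have [c cI E] := MVT_segment ler01 (fun s _ => dpsiP s) psi_cont.
have dpsi_le0 : dpsi c <= 0.
  have := cauchy_schwarz (grad f (c *: h + x) - grad f x) h.
  have c01 : 0 <= c <= 1 by move: cI; rewrite in_itv.
  have := ler_wpM2r (l2norm_ge0 h) (smooth c c01).
  rewrite dotBl /dpsi -/A /B; lra.
move: E; rewrite /psi scale1r scale0r add0r [h + x]addrC subr0 mulr1.
rewrite -/A -/B; lra.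
Qed.

(** In the quadratic bound, the scalar product of the gradient and [g] is
    expressed by polarization through the squared norms of both and of their
    difference; since [alpha * L <= 1 / 6], the quadratic term leaves
    [1 / 2 - 1 / 12 = 5 / 12] of the squared norm of [g]. *)
Lemma gradient_step_descent (R : realType) (d : nat) (f : 'rV[R]_d -> R)
    (L D alpha : R) (X : set 'rV[R]_d) (x g : 'rV[R]_d) :
  locally_smooth L D X f -> X x -> 0 < alpha -> alpha * L <= 1 / 6 ->
  alpha * l2norm g <= D ->
  f (x - alpha *: g) <= f x - alpha / 2 * l2norm (grad f x) ^+ 2
    - 5 / 12 * alpha * l2norm g ^+ 2
    + alpha / 2 * l2norm (g - grad f x) ^+ 2.
Proof.
move=> [df smooth] Xx alpha0 aL gD.
have step_norm : l2norm (- (alpha *: g)) = alpha * l2norm g.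
  by rewrite l2normN l2normZ gtr0_norm.
have := @smooth_upper_bound R d f L x (- (alpha *: g)) df.
rewrite step_norm => /(_ _) ub.
have /ub : forall s, 0 <= s <= 1 ->
    l2norm (grad f (s *: - (alpha *: g) + x) - grad f x) <=
    L * (s * (alpha * l2norm g)).
  move=> s /andP[s0 s1].
  have sE : l2norm (s *: - (alpha *: g)) = s * (alpha * l2norm g).
    by rewrite l2normZ step_norm ger0_norm.
  rewrite l2norm_distC -sE -[in leRHS]l2normN.
  have -> : - (s *: - (alpha *: g)) = x - (s *: - (alpha *: g) + x).
    by rewrite opprD addrCA subrr addr0.
  apply: smooth => //; rewrite addrK sE; apply: le_trans gD.
  by rewrite ler_piMl // mulr_ge0 ?l2norm_ge0 // ltW.
have := l2norm_sqrD g (- grad f x).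
rewrite l2normN -scaleNr dotZr -[- grad f x]scaleN1r dotZr.
have -> : dot g (grad f x) = dot (grad f x) g.
  by apply: eq_bigr => i _; rewrite mulrC.
have : alpha * L * (alpha * l2norm g ^+ 2) <= 1 / 6 * (alpha * l2norm g ^+ 2).
  by apply: ler_wpM2r => //; rewrite mulr_ge0 ?sqr_ge0 // ltW.
set N := l2norm (grad f x); set e := l2norm (_ + _ *: _); set u := dot _ _.
set ng := l2norm g => h1 h2 h3.
have -> : alpha / 2 * e ^+ 2 = alpha / 2 * (ng ^+ 2 + 2 * (-1 * u) + N ^+ 2).
  by rewrite h2.
lra.
Qed.

(** Here [gh] and [gh'] are consecutive noisy gradients and [P] bounds the
    quantization error, so the bound obtained is the next quantizer range. *)
Lemma innovation_in_range (R : realType) (d : nat) (f : 'rV[R]_d -> R)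
    (L D alpha P e e' : R) (X : set 'rV[R]_d)
    (x g gh gh' : 'rV[R]_d) :
  locally_smooth L D X f -> X x -> 0 < alpha -> alpha * l2norm g <= D ->
  l2norm (gh - grad f x) <= e ->
  l2norm (gh' - grad f (x - alpha *: g)) <= e' ->
  l2norm (g - gh) <= P ->
  l2norm (gh' - g) <= P + alpha * L * l2norm g + e + e'.
Proof.
move=> [_ smooth] Xx alpha0 gD he he' hP.
have hs : l2norm (grad f x - grad f (x - alpha *: g)) <= alpha * L * l2norm g.
  have -> : alpha * L * l2norm g = L * l2norm (x - (x - alpha *: g)).
    by rewrite opprB addrC subrK l2normZ gtr0_norm //; ring.
  by apply: smooth => //; rewrite addrC addrA addNr add0r l2normN l2normZ gtr0_norm.
set x' := x - alpha *: g in he' hs *.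
have -> : gh' - g = (gh' - grad f x') + ((grad f x' - grad f x) +
     ((grad f x - gh) + (gh - g))).
  by rewrite !addrA !subrK.
have t1 := ler_l2normD (gh' - grad f x') ((grad f x' - grad f x) +
     ((grad f x - gh) + (gh - g))).
have t2 := ler_l2normD (grad f x' - grad f x) ((grad f x - gh) + (gh - g)).
have t3 := ler_l2normD (grad f x - gh) (gh - g).
have := l2norm_distC (grad f x') (grad f x).
have := l2norm_distC gh (grad f x); have := l2norm_distC gh g.
lra.
Qed.

(** * The contraction factor *)

Lemma ln2_ge_half (R : realType) : 1 / 2 <= ln (2 : R).
Proof.
have := @le_ln1Dx R (- (1 / 2)).
have -> : 1 + - (1 / 2) = (2 : R)^-1 by field.
rewrite lnV ?posrE // => h; suff : - ln (2 : R) <= - (1 / 2) by lra.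
by apply: h; lra.
Qed.

(** For [d >= 2], the logarithm is at least [ln d] and [ln 2 >= 1 / 2], so the
    hypothesis with factor 4 forces [d ^ 2 <= 2 ^ b].  For [d = 1] the logarithm
    can be arbitrarily small, and [0 < b] alone gives the bound. *)
Lemma contraction_factor_le_half (R : realType) (d b : nat) (kappa : R) :
  (0 < d)%N -> (0 < b)%N -> 1 < kappa ->
  4 * ln (d%:R * kappa / (kappa - 1)) <= b%:R ->
  Num.sqrt (d%:R : R) / 2 ^+ b <= 1 / 2.
Proof.
move=> d0 b0 kappa1 hb.
have dR : (0 : R) < d%:R by rewrite ltr0n.
suff h : 2 * Num.sqrt (d%:R : R) <= 2 ^+ b.
  by rewrite ler_pdivrMr ?exprn_gt0 //; lra.
have [d2|] := leqP 2 d; last first.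
  case: d d0 {hb dR} => [//|[_ _|//]]; rewrite sqrtr1 mulr1.
  by rewrite -[leLHS]expr1 ler_eXn2l // ltr1n.
have d2R : (2 : R) <= d%:R by rewrite ler_nat.
have dk : d%:R <= d%:R * kappa / (kappa - 1).
  rewrite ler_pdivlMr ?subr_gt0 // ler_pM2l //; lra.
have lnd : ln (d%:R : R) <= ln (d%:R * kappa / (kappa - 1)).
  by rewrite ler_ln ?posrE // (lt_le_trans dR).
have dsq : (d%:R : R) ^+ 2 <= 2 ^+ b.
  rewrite -ler_ln ?posrE ?exprn_gt0 // !lnXn // -[leRHS]mulr_natl mulr2n.
  have : b%:R * (1 / 2) <= b%:R * ln (2 : R).
    by rewrite ler_wpM2l ?ln2_ge_half.
  lra.
have sq : Num.sqrt (d%:R : R) <= d%:R.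
  rewrite -ler_sqr ?nnegrE ?sqrtr_ge0 ?ler0n // sqr_sqrtr ?ler0n //.
  by rewrite expr2 ler_peMl ?ler0n //; lra.
apply: le_trans dsq; rewrite expr2.
apply: (@le_trans _ _ (2 * d%:R)); first by rewrite ler_pM2l.
by rewrite ler_pM2r.
Qed.

(** * The Lyapunov function *)

(** After division by [a], the claim is the nonnegativity of a quadratic form
    in [P] (or [N]), [n] and [e].  In the first case, [a * m <= 1 / 6] leaves
    [11 / 12] of [P ^ 2]: one half is spent on the gradient error and one
    quarter on the next value [P'].  In the second case gradient domination
    uses half of [N ^ 2 / 2] for the contraction, and [P = N / 2] makes the
    other half sufficient. *)
Lemma potential_decrease (R : realType) (a m N n e P P' dl dl' V : R) :
  0 < a -> 0 < m -> a * m <= 1 / 6 -> 0 <= dl -> 2 * m * dl <= N ^+ 2 ->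
  0 <= P' -> P' <= P / 2 + n / 12 + 3 / 4 * e ->
  dl' <= dl - a / 2 * N ^+ 2 - 5 / 12 * a * n ^+ 2
         + a / 2 * (P + 3 / 2 * e) ^+ 2 ->
  V = dl + a * P ^+ 2 \/ V = dl /\ P = N / 2 ->
  dl' + a * P' ^+ 2 <= (1 - a * m / 2) * V + 15 * a * e ^+ 2.
Proof.
move=> a0 m0 am dl0 pl P'0 P'le descent hV.
set S := P / 2 + n / 12 + 3 / 4 * e in P'le.
have P'sq : a * P' ^+ 2 <= a * S ^+ 2.
  rewrite ler_pM2l // ler_sqr // ?nnegrE //; exact: le_trans P'le.
have apl : a * (2 * m * dl) <= a * N ^+ 2 by rewrite ler_pM2l.
have amdl : 0 <= a * m * dl by rewrite !mulr_ge0 // ltW.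
case: hV => [->|[-> PE]].
- have amP : a * m * (a * P ^+ 2) <= 1 / 6 * (a * P ^+ 2).
    by apply: ler_wpM2r => //; rewrite mulr_ge0 ?sqr_ge0 // ltW.
  have : 0 <= a * (5 / 12 * n ^+ 2 + 11 / 12 * P ^+ 2 + 15 * e ^+ 2
      - 1 / 2 * (P + 3 / 2 * e) ^+ 2 - S ^+ 2).
    apply: mulr_ge0; first exact: ltW.
    rewrite /S.
    (* The weights balance the mixed terms against the coefficients
       [1 / 6] of [P ^ 2], about [0.4] of [n ^ 2] and [13] of [e ^ 2]. *)
    have := sqr_ge0 (P - 10 * e); have := sqr_ge0 (P - n).
    have := sqr_ge0 (n - e); have := sqr_ge0 e; have := sqr_ge0 n; nra.
  lra.
- have : 0 <= a * (5 / 12 * n ^+ 2 + 1 / 4 * N ^+ 2 + 15 * e ^+ 2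
      - 1 / 2 * (P + 3 / 2 * e) ^+ 2 - S ^+ 2).
    apply: mulr_ge0; first exact: ltW.
    rewrite /S PE.
    have := sqr_ge0 (N - 12 * e); have := sqr_ge0 (N - n).
    have := sqr_ge0 (n - e); have := sqr_ge0 e; have := sqr_ge0 n; nra.
  lra.
Qed.

(** At the level [F = 90 * e ^ 2 / m] the noise term equals [a * m / 6 * F],
    which is the gap between the two rates: above it [V] contracts at the
    slower rate, below it [V'] stays below. *)
Lemma contraction_or_noise_floor (R : realType) (a m V V' e : R) :
  0 < a -> 0 < m -> a * m <= 1 / 6 ->
  V' <= (1 - a * m / 2) * V + 15 * a * e ^+ 2 ->
  V' <= Num.max ((1 - a * m / 3) * V) (90 * e ^+ 2 / m).
Proof.
move=> a0 m0 am h; rewrite le_max.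
set F := 90 * e ^+ 2 / m.
have FE : 15 * a * e ^+ 2 = a * m / 6 * F.
  by rewrite /F; field; rewrite gt_eqF.
rewrite FE in h.
have am0 : 0 < a * m by rewrite mulr_gt0.
have F0 : 0 <= F by apply: divr_ge0 (ltW m0); rewrite mulr_ge0 ?sqr_ge0.
have [FV|VF] := leP F V; apply/orP; [left|right].
- have : a * m * F <= a * m * V by rewrite ler_pM2l.
  lra.
- have : (1 - a * m / 2) * V <= (1 - a * m / 2) * F.
    by rewrite ler_wpM2l ?(ltW VF) //; lra.
  have : 0 <= a * m * F by rewrite mulr_ge0 // ltW.
  lra.
Qed.

(** * The rate and the theorem *)

Lemma eps_bar2_ge (R : realType) (alpha mu : R) (eps : nat -> R) (t : nat) :
  6 * eps t ^+ 2 <= eps_bar2 alpha mu eps t.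
Proof.
apply: le_trans (le_bigmax _ _ (@ord_max t)).
by rewrite subnn expr0 mul1r lerDr mulr_ge0 ?sqr_ge0.
Qed.

Lemma eps_bar2_decay (R : realType) (alpha mu : R) (eps : nat -> R) (t : nat) :
  0 <= 1 - alpha * mu / 3 ->
  (1 - alpha * mu / 3) * eps_bar2 alpha mu eps t <= eps_bar2 alpha mu eps t.+1.
Proof.
move=> rho0; set rho := 1 - _ in rho0 *.
have nn (s : nat) : 0 <= 8 * delayed eps s ^+ 2 + 6 * eps s ^+ 2.
  by rewrite addr_ge0 // mulr_ge0 ?sqr_ge0.
rewrite {1}/eps_bar2 -/rho.
apply: (big_ind (fun y => rho * y <= eps_bar2 alpha mu eps t.+1))
  => [|u w hu hw|s _].
- rewrite mulr0; apply: le_trans (le_bigmax _ _ ord0).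
  by rewrite mulr_ge0 // exprn_ge0.
- by rewrite maxr_pMr // ge_max hu hw.
- apply: le_trans (le_bigmax _ _ (widen_ord (leqnSn _) s)) => /=.
  by rewrite mulrA -exprS subSn // -ltnS.
Qed.

(** The constant 90 is 15 times the weight 6 of the most recent noise in
    [eps_bar2]. *)
Lemma rate_bound_step (R : realType) (alpha mu dl0 : R) (eps : nat -> R)
    (M := fun t => Num.max ((1 - alpha * mu / 3) ^+ t * dl0)
                           (15 * delayed (eps_bar2 alpha mu eps) t / mu))
    (t : nat) :
  0 < mu -> 0 <= 1 - alpha * mu / 3 ->
  Num.max ((1 - alpha * mu / 3) * M t) (90 * eps t ^+ 2 / mu) <= M t.+1.
Proof.
move=> mu0 rho0; rewrite /M ge_max maxr_pMr // ge_max mulrA -exprS.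
rewrite !le_max lexx /=; apply/andP; split; apply/orP; right.
- case: t => [|t] /=.
    rewrite mulr0 mul0r mulr0; apply: divr_ge0 (ltW mu0); apply: mulr_ge0 => //.
    by apply: le_trans (eps_bar2_ge _ _ _ _); rewrite mulr_ge0 ?sqr_ge0.
  rewrite mulrA ler_pM2r ?invr_gt0 // mulrCA ler_pM2l //.
  exact: eps_bar2_decay.
- rewrite ler_pM2r ?invr_gt0 //=.
  have := eps_bar2_ge alpha mu eps t; lra.
Qed.

(* The hypothesis on [2 * gamma * r 0] bounds the error of the first
   quantization.  Without any upper bound on the initial range the claim fails:
   if x 0 = xs, eps = 0 and 0 < r 0, then g 0 <> 0, as no bin center is 0.
   It holds in particular when [r 0 <= l2norm (grad f (x 0)) + eps 0] and
   gamma <= 1/2, e.g. for [r 0 = l2norm (ghat 0)]. *)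
Theorem theorem4p2 (R : realType) :
  exists C : R, 1 <= C /\
  forall (d : nat) (f : 'rV[R]_d -> R) (L D G mu v : R) (xs : 'rV[R]_d)
         (alpha gamma : R) (b : nat) (Q : R -> 'rV[R]_d -> 'rV[R]_d)
         (eps : nat -> R) (ghat x g : nat -> 'rV[R]_d) (r : nat -> R),
  let X := [set z : 'rV[R]_d | f z <= v] in
  let kappa := L / mu in
  (0 < d)%N ->
  0 < L -> 0 < D -> 0 < G -> 0 < mu -> 0 <= v ->
  (forall z, 0 <= f z) ->
  locally_smooth L D X f ->
  (forall z, X z -> l2norm (grad f z) <= G) ->
  is_argmin X f xs ->
  (forall z, X z -> 2 * mu * (f z - f xs) <= l2norm (grad f z) ^+ 2) ->
  1 < kappa ->
  f (x 0%N) <= v / 4 ->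
  0 < alpha <= Num.min (D / (7 * G)) (1 / (6 * L)) ->
  (0 < b)%N ->
  gamma = Num.sqrt d%:R / 2 ^+ b ->
  C * ln (d%:R * kappa / (kappa - 1)) <= b%:R ->
  is_scalar_quantizer b Q ->
  NAQGD_run Q alpha gamma L eps ghat x g r ->
  2 * gamma * r 0%N <= l2norm (grad f (x 0%N)) + eps 0%N ->
  (forall t, 0 <= eps t) ->
  (forall t, l2norm (ghat t - grad f (x t)) <= eps t) ->
  (forall t, eps t <= G /\ eps_bar2 alpha mu eps t <= v * mu / 60) ->
  forall t,
    f (x t) <= v / 2 /\
    f (x t) - f xs <=
      Num.max ((1 - alpha * mu / 3) ^+ t * (f (x 0%N) - f xs))
              (15 * delayed (eps_bar2 alpha mu eps) t / mu).
Proof.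
exists 4; split; first by lra.
move=> d f L D G mu v xs alpha gamma b Q eps ghat x g r X kappa.
move=> d0 L0 D0 G0 mu0 v0 f0 smooth gradG [Xxs xsmin] pl kappa1 fx0.
rewrite le_min => /andP[alpha0 /andP[alphaD alphaL]] b0 gammaE hb hQ.
case=> range0 gE xE rE init eps0 heps noise.
have gamma_half : gamma <= 1 / 2.
  by rewrite gammaE; exact: contraction_factor_le_half hb.
have gamma0 : 0 <= gamma by rewrite gammaE divr_ge0 ?sqrtr_ge0 ?exprn_ge0.
have aL : alpha * L <= 1 / 6.
  move: alphaL; rewrite ler_pdivlMr; [lra|exact: mulr_gt0].
have aG : alpha * (7 * G) <= D by rewrite -ler_pdivlMr // mulr_gt0.
have am : alpha * mu <= 1 / 6.
  apply: le_trans aL; rewrite ler_pM2l //.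
  by move: kappa1; rewrite /kappa ltr_pdivlMr // mul1r; exact: ltW.
have am0 : 0 < alpha * mu by rewrite mulr_gt0.
have rho0 : 0 <= 1 - alpha * mu / 3 by lra.
have X0 : X (x 0%N) by rewrite /X /=; lra.
pose dl t := f (x t) - f xs.
have dl0_ge0 : 0 <= dl 0%N by rewrite subr_ge0; exact: xsmin.
have dl0_le : dl 0%N <= v / 4 by have := f0 xs; rewrite /dl; lra.
pose M t := Num.max ((1 - alpha * mu / 3) ^+ t * dl 0%N)
                    (15 * delayed (eps_bar2 alpha mu eps) t / mu).
have M_le t : M t <= v / 4.
  rewrite /M ge_max; apply/andP; split.
    apply: le_trans dl0_le; rewrite ler_piMl // exprn_ile1 //; lra.
  rewrite ler_pdivrMr //; case: t => [|t] /=.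
    by rewrite mulr0 mulr_ge0 ?divr_ge0 // ltW.
  by have [_] := noise t; lra.
have sublevel t : dl t <= M t -> f (x t) <= v / 2.
  have := M_le t; have := xsmin _ X0; rewrite /dl; lra.
suff inv t : exists P V, [/\ dl t <= V, V <= M t,
    V = dl t + alpha * P ^+ 2 \/ V = dl t /\ P = l2norm (grad f (x t)) / 2,
    gamma * r t <= P + eps t / 2 &
    l2norm (ghat t - delayed g t) <= r t /\ gamma * r t <= 5 * G].
  move=> t; have [P [V [dlV VM _ _ _]]] := inv t.
  by have dlM := le_trans dlV VM; split => //; exact: sublevel.
(* [P] and [V] stand for [P_t] and [V_t]; the disjunction separates [t > 0] from
   the start. *)
elim: t => [|t [P [V [dlV VM VE rP [ir r5]]]]].
  exists (l2norm (grad f (x 0%N)) / 2), (dl 0%N); split => //.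
  - by rewrite /M expr0 mul1r le_max lexx.
  - by right.
  - lra.
  - split; first by rewrite /= subr0.
    by have := gradG _ X0; have [] := noise 0%N; lra.
have Xt : X (x t).
  by rewrite /X /=; have := sublevel _ (le_trans dlV VM); lra.
have r0 : 0 <= r t := le_trans (l2norm_ge0 _) ir.
have gr0 : 0 <= gamma * r t by rewrite mulr_ge0.
set N := l2norm (grad f (x t)) in VE *; set n := l2norm (g t).
have n0 : 0 <= n := l2norm_ge0 _.
have quant : l2norm (g t - ghat t) <= gamma * r t.
  have -> : g t - ghat t =
      Q (r t) (ghat t - delayed g t) - (ghat t - delayed g t).
    by rewrite {1}gE opprB addrCA addrA.
  by rewrite gammaE; exact: quantization_error.
have err : l2norm (g t - grad f (x t)) <= gamma * r t + eps t.
  have := ler_l2normD (g t - ghat t) (ghat t - grad f (x t)).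
  by rewrite addrA subrK; have := heps t; lra.
have n_le : n <= 2 * G + gamma * r t.
  have := ler_l2normD (g t - grad f (x t)) (grad f (x t)).
  rewrite subrK -/n; have := gradG _ Xt; have [] := noise t; lra.
have nD : alpha * n <= D by apply: le_trans aG; rewrite ler_pM2l //; lra.
have aLn : alpha * L * n <= n / 6.
  by rewrite (mulrC n) ler_wpM2r //; lra.
have aLn0 : 0 <= alpha * L * n by rewrite !mulr_ge0 // ltW.
pose P' := gamma * (r t.+1 - eps t.+1).
have P'E : P' = gamma * (gamma * r t + alpha * L * n + eps t).
  by rewrite /P' rE -/n; congr (_ * _); ring.
have P'0 : 0 <= P' by rewrite P'E mulr_ge0 // !addr_ge0.
have P'le : P' <= P / 2 + n / 12 + 3 / 4 * eps t.
  apply: (@le_trans _ _ (1 / 2 * (gamma * r t + alpha * L * n + eps t))).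
    by rewrite P'E ler_wpM2r // !addr_ge0.
  lra.
have descent : dl t.+1 <= dl t - alpha / 2 * N ^+ 2
    - 5 / 12 * alpha * n ^+ 2 + alpha / 2 * (P + 3 / 2 * eps t) ^+ 2.
  have err2 : l2norm (g t - grad f (x t)) ^+ 2 <= (P + 3 / 2 * eps t) ^+ 2.
    have le1 : l2norm (g t - grad f (x t)) <= P + 3 / 2 * eps t by lra.
    have e0 := l2norm_ge0 (g t - grad f (x t)).
    by rewrite ler_sqr // nnegrE // (le_trans e0).
  have := gradient_step_descent smooth Xt alpha0 aL nD.
  rewrite -xE /dl -/N -/n.
  have : alpha / 2 * l2norm (g t - grad f (x t)) ^+ 2 <=
         alpha / 2 * (P + 3 / 2 * eps t) ^+ 2.
    by rewrite ler_pM2l // divr_gt0.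
  lra.
have dlt0 : 0 <= dl t by rewrite subr_ge0; exact: xsmin.
have decrease :=
  potential_decrease alpha0 mu0 am dlt0 (pl _ Xt) P'0 P'le descent VE.
exists P', (dl t.+1 + alpha * P' ^+ 2); split.
- by rewrite lerDl mulr_ge0 ?sqr_ge0 // ltW.
- apply: le_trans (contraction_or_noise_floor alpha0 mu0 am decrease) _.
  apply: le_trans (rate_bound_step (dl 0%N) eps t mu0 rho0).
  by rewrite ge_max !le_max lexx orbT andbT ler_wpM2l.
- by left.
- have : gamma * eps t.+1 <= 1 / 2 * eps t.+1 by rewrite ler_wpM2r.
  by rewrite /P'; lra.
- split.
    rewrite rE; apply: innovation_in_range smooth Xt alpha0 nD (heps t) _ quant.
    by rewrite -xE.
  have [et _] := noise t; have [et' _] := noise t.+1.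
  (* [1 / 2 * (7 / 6 * 5 * G + 7 / 3 * G) = 49 / 12 * G <= 5 * G] *)
  apply: (@le_trans _ _ (1 / 2 * r t.+1)).
    by rewrite ler_wpM2r // rE !addr_ge0.
  rewrite rE -/n; lra.
Qed.
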